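(* There exists an optimal $(v,4,1)$-optical orthogonal code for every positive integer $v\equiv 1,4\pmod{12}$ with $v\notin\{16,25,28\}$.
   Context: A $(v,k,1)$-optical orthogonal code (OOC) $\mathcal{C}$ is a family of $(0,1)$-sequences (codewords) of length $v$ and weight $k$ such that for any $\mathbf{x}=(x_0,\dots,x_{v-1})\in\mathcal{C}$, $\mathbf{y}=(y_0,\dots,y_{v-1})\in\mathcal{C}$ and any integer $r$, $\sum_{i=0}^{v-1}x_iy_{i+r}\le 1$ whenever $\mathbf{x}\ne\mathbf{y}$ or $r\ne 0$ (indices taken modulo $v$). A $(v,k,1)$-OOC is optimal if it has $\lfloor (v-1)/(k(k-1))\rfloor$ codewords. *)

(* Defs.v *)
From mathcomp Require Import all_boot.
Set Implicit Arguments. Unset Strict Implicit. Unset Printing Implicit Defensive.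

Definition weight (x : seq bool) : nat := count id x.

Definition corr (v : nat) (x y : seq bool) (r : nat) : nat :=
  \sum_(i < v) (nth false x i && nth false y ((i + r) %% v)).

Definition is_OOC (v k : nat) (C : seq (seq bool)) : Prop :=
  uniq C /\
  (forall x, x \in C -> size x = v /\ weight x = k) /\
  (forall x y, x \in C -> y \in C -> forall r, r < v ->
     (x != y) || (r != 0) -> corr v x y r <= 1).

Definition is_optimal_OOC (v k : nat) (C : seq (seq bool)) : Prop :=
  is_OOC v k C /\ size C = (v - 1) %/ (k * (k - 1)).

(* Main.v *)
(**
Call t triples (x, y, z) perfect if the 6 t differences x, y, z, x + y, y + z,
x + y + z of the blocks {0, x, x + y, x + y + z} are exactly 1, ..., 6 t. Since
6 t < v / 2, no two differences agree up to sign modulo v, so the blocks form an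
optimal code both for v = 12 t + 1 and for v = 12 t + 4.

Perfect families exist for all t >= 4. For each residue of t modulo 6 there is one
parametrised by n = t / 6: six families of about n triples each,
of the form (x + d j, y + e j, z + f j), together with 12 or 13 single triples, where
x, y, z are affine functions of n. The slopes of the four points of the moving block
are 0, 1, 2, 3 in some order, so the differences form progressions of steps 1, 2 and 3.
Two progressions of step 2, or three of step 3, in distinct residue classes interleave
to fill an interval, and the single triples fill the gaps between such intervals.
That 1, ..., 6 t is covered is decided by walking along affine functions of n; as
there are only 6 t differences, no difference is repeated.
*)
Require Import Defs.
From Stdlib Require Import ZArith.
From mathcomp Require Import all_boot ssrZ zify.
Set Implicit Arguments. Unset Strict Implicit. Unset Printing Implicit Defensive.

(** * Codewords as point sets, and their correlations *)

Definition codeword (v : nat) (X : seq nat) : seq bool :=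
  mkseq (fun i => i \in X) v.

Lemma weight_codeword v X :
  uniq X -> all (fun i => i < v) X -> weight (codeword v X) = size X.
Proof.
move=> uX ltX; rewrite /weight /codeword /mkseq count_map -size_filter.
apply/perm_size/uniq_perm => // [|i]; first by rewrite filter_uniq ?iota_uniq.
rewrite mem_filter mem_iota add0n /=; case iX: (i \in X) => //=.
exact: (allP ltX).
Qed.

Lemma nth_codeword v X i : i < v -> nth false (codeword v X) i = (i \in X).
Proof. by move=> ltiv; rewrite nth_mkseq. Qed.

Lemma corr_le1 v X Y r :
  (forall i j, i < v -> j < v -> i \in X -> j \in X ->
    (i + r) %% v \in Y -> (j + r) %% v \in Y -> i = j) ->
  corr v (codeword v X) (codeword v Y) r <= 1.
Proof.
move=> inj1; pose P := [set i : 'I_v | ((i : nat) \in X) && ((i + r) %% v \in Y)].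
have -> : corr v (codeword v X) (codeword v Y) r = #|P|.
  rewrite -sum1_card /corr [RHS]big_mkcond; apply: eq_bigr => i _.
  rewrite !nth_codeword ?ltn_ord ?ltn_pmod ?(leq_ltn_trans _ (ltn_ord i)) // inE.
  by case: (_ && _).
apply/card_le1_eqP => i j; rewrite !inE => /andP[Xi Yi] /andP[Xj Yj].
apply: val_inj; apply: inj1; rewrite ?ltn_ord //.
Qed.

(** The last hypothesis is the congruence [i - j = i' - j'] written without subtraction. Two
    coincidences of [X] with [Y] under the shift [r] give equal differences, so [X = Y] and
    [i = (i + r) %% v], whence [r = 0]. *)
Lemma OOC_of_blocks v k (B : seq (seq nat)) :
    1 < k -> uniq B ->
    {in B, forall X, [/\ size X = k, uniq X & all (fun i => i < v) X]} ->
    {in B &, forall X Y i j i' j', i \in X -> j \in X -> i' \in Y -> j' \in Y ->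
       i != j -> i + j' = i' + j %[mod v] -> X = Y /\ i = i'} ->
  is_OOC v k (map (codeword v) B).
Proof.
move=> k_gt1 uB okB diffB; split; last split.
- rewrite map_inj_in_uniq // => X Y BX BY eqXY.
  have [szX uX ltX] := okB X BX; have [szY uY ltY] := okB Y BY.
  have sXY i : i \in X -> i \in Y.
    by move=> Xi; have ltiv := allP ltX i Xi; rewrite -(nth_codeword Y ltiv) -eqXY nth_codeword.
  (* Blocks with equal codewords share two distinct points, since [k > 1]; the difference of these
     points determines the block. *)
  have X0 : nth 0 X 0 \in X by rewrite mem_nth // szX; lia.
  have X1 : nth 0 X 1 \in X by rewrite mem_nth // szX.
  have neX : nth 0 X 0 != nth 0 X 1 by rewrite nth_uniq ?szX ?(ltnW k_gt1).
  by have [] := diffB X Y BX BY _ _ _ _ X0 X1 (sXY _ X0) (sXY _ X1) neX erefl.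
- move=> _ /mapP[X BX ->]; have [szX uX ltX] := okB X BX.
  by rewrite weight_codeword // size_mkseq.
- move=> _ _ /mapP[X BX ->] /mapP[Y BY ->] r ltrv nXYr; apply: corr_le1 => i j ltiv ltjv Xi Xj Yi Yj.
  apply/eqP; apply: contraLR nXYr => neij.
  have [|eqXY eqi] := diffB X Y BX BY i j _ _ Xi Xj Yi Yj neij.
    by rewrite modnDmr modnDml; congr (_ %% _); lia.
  rewrite eqXY eqxx /= negbK; apply/eqP.
  case: (ltnP (i + r) v) eqi => [/modn_small-> | leviR]; first lia.
  by rewrite -(subnK leviR) modnDr modn_small; lia.
Qed.

(** * Difference triples and their blocks *)

Lemma uniq_map_inj (T1 T2 : eqType) (f : T1 -> T2) (s : seq T1) :
  uniq (map f s) -> {in s &, injective f}.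
Proof.
elim: s => [//|a s IH] /= /andP[fa us] x y; rewrite !inE.
case/predU1P=> [->|sx] /predU1P[->|sy] // eqf.
- by rewrite eqf map_f in fa.
- by rewrite -eqf map_f in fa.
- exact: IH.
Qed.

Definition diffs (T : nat * nat * nat) : seq nat :=
  let: (x, y, z) := T in [:: x; y; z; x + y; y + z; x + y + z].

Definition block (T : nat * nat * nat) : seq nat :=
  let: (x, y, z) := T in [:: 0; x; x + y; x + y + z].

(** Listed in the order of [diffs]. Keeping the pairs, tagged with their triple, turns uniqueness of
    differences into injectivity: a difference determines the triple and both points. *)
Definition gaps (T : nat * nat * nat) : seq (nat * nat) :=
  let: (x, y, z) := T in
  [:: (0, x); (x, x + y); (x + y, x + y + z); (0, x + y); (x, x + y + z); (0, x + y + z)].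

Definition all_diffs (B : seq (nat * nat * nat)) : seq nat := flatten (map diffs B).

Lemma diffs_gaps T : diffs T = [seq p.2 - p.1 | p <- gaps T].
Proof.
by case: T => [[x y] z] /=; congr [:: _; _; _; _; _; _]; lia.
Qed.

Lemma all_diffs_gaps B :
  all_diffs B = [seq q.2.2 - q.2.1 | q <- [seq (T, p) | T <- B, p <- gaps T]].
Proof.
rewrite /all_diffs map_flatten -!map_comp; congr flatten; apply: eq_map => T /=.
by rewrite diffs_gaps -map_comp.
Qed.

Lemma mem_gaps T i j :
  i \in block T -> j \in block T -> i < j -> (i, j) \in gaps T.
Proof.
case: T => [[x y] z]; rewrite /block /gaps !inE.
by case/or4P=> /eqP-> /or4P[] /eqP->; rewrite ?eqxx ?orbT //; lia.
Qed.

Lemma mem_all_diffs B T d : T \in B -> d \in diffs T -> d \in all_diffs B.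
Proof. by move=> BT Td; apply/flattenP; exists (diffs T) => //; apply: map_f. Qed.

Lemma block_diff T i j :
  i \in block T -> j \in block T -> i < j -> j - i \in diffs T.
Proof.
by move=> Ti Tj ltij; rewrite diffs_gaps (map_f (fun p => p.2 - p.1) (mem_gaps Ti Tj ltij)).
Qed.

Lemma block_diff_inj B T T' i j i' j' :
    uniq (all_diffs B) -> T \in B -> T' \in B ->
    i \in block T -> j \in block T -> i' \in block T' -> j' \in block T' ->
  i < j -> i' < j' -> j - i = j' - i' -> [/\ T = T', i = i' & j = j'].
Proof.
rewrite all_diffs_gaps => /uniq_map_inj inj BT BT' Ti Tj Ti' Tj' ltij ltij' eqd.
have memP S k l : S \in B -> k \in block S -> l \in block S -> k < l ->
    (S, (k, l)) \in [seq (S, p) | S <- B, p <- gaps S].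
  by move=> BS Sk Sl ltkl; apply/allpairsPdep; exists S, (k, l); rewrite mem_gaps.
by have [-> -> ->] := inj _ _ (memP T i j BT Ti Tj ltij) (memP T' i' j' BT' Ti' Tj' ltij') eqd.
Qed.

Lemma eqmod_lt_double v a b :
  a = b %[mod v] -> a < v + v -> b < v + v -> [\/ a = b, a = b + v | b = a + v].
Proof.
move=> eqab lta ltb; move: eqab.
have red c : c < v + v -> c %% v = if c < v then c else c - v.
  move=> ltc; case: (ltnP c v) => [/modn_small// | levc].
  by rewrite -[in LHS](subnK levc) modnDr modn_small //; lia.
rewrite !red //; case: (ltnP a v) => ? ; case: (ltnP b v) => ? eqab;
  [constructor 1 | constructor 3 | constructor 2 | constructor 1]; lia.
Qed.

(** In terms of positive differences, the congruence means equality when both pairs are ordered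
    alike, and a sum of [v] when they are ordered oppositely. *)
Lemma eqmod_gaps v i j i' j' :
    i != j -> i < v -> j < v -> i' < v -> j' < v -> i + j' = i' + j %[mod v] ->
  [\/ [/\ i < j, i' < j' & j - i = j' - i'], [/\ j < i, j' < i' & i - j = i' - j'],
      [/\ i < j, j' < i' & j - i + (i' - j') = v] | [/\ j < i, i' < j' & i - j + (j' - i') = v]].
Proof.
move=> neij lti ltj lti' ltj' /eqmod_lt_double[||E|E|E]; try lia;
  case: (ltngtP i j) neij => // ltij _.
- by constructor 1; split; lia.
- by constructor 2; split; lia.
- by constructor 4; split; lia.
- by constructor 4; split; lia.
- by constructor 3; split; lia.
- by constructor 3; split; lia.
Qed.

Lemma uniq_triples B : uniq (all_diffs B) -> uniq B.
Proof.
elim: B => [//|T B IH]; rewrite /all_diffs map_cons -cat1s flatten_cat cat_uniq /= cats0.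
case/and3P=> _ /hasPn dTB /IH->; rewrite andbT; apply/negP => BT.
have Tx: T.1.1 \in diffs T by case: (T) => [[x y] z]; rewrite inE eqxx.
by have /negP := dTB _ (mem_all_diffs BT Tx).
Qed.

(** Uniqueness separates the differences from each other; the condition on sums, with [d = e]
    allowed, separates them from their negatives modulo [v]. *)
Lemma OOC_of_triples v (B : seq (nat * nat * nat)) :
    uniq (all_diffs B) ->
    {in all_diffs B, forall d, 0 < d < v} ->
    {in all_diffs B &, forall d e, d + e <> v} ->
  is_OOC v 4 (map (codeword v) (map block B)).
Proof.
move=> uB rB sB.
have rT T d : T \in B -> d \in diffs T -> 0 < d < v.
  by move=> BT Td; apply: rB (mem_all_diffs BT Td).
have ltT T i : T \in B -> i \in block T -> i < v.
  (* The largest point [x + y + z] is itself a difference. *)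
  case: T => [[x y] z] /rT rxyz; have := rxyz (x + y + z).
  rewrite !inE eqxx !orbT => /(_ isT) lev.
  by case/or4P => /eqP->; lia.
apply: OOC_of_blocks => //.
- rewrite map_inj_uniq ?uniq_triples // => -[[x y] z] [[x' y'] z'] [-> e1 e2].
  by congr (_, _, _); lia.
- move=> _ /mapP[T BT ->]; split; last by apply/allP => i; apply: ltT.
    by case: (T) => [[x y] z].
  case: T BT => [[x y] z] /rT rxyz.
  have [x0 y0 z0] : [/\ 0 < x, 0 < y & 0 < z].
    by split; [have := rxyz x | have := rxyz y | have := rxyz z];
      rewrite !inE eqxx ?orbT => /(_ isT) /andP[].
  by rewrite /= !inE; lia.
- move=> _ _ /mapP[T BT ->] /mapP[T' BT' ->] i j i' j' Ti Tj Ti' Tj' neij eqd.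
  have key := block_diff_inj uB BT BT'.
  have sd k l k' l' Tk Tl kl Tk' Tl' kl' :=
    sB _ _ (mem_all_diffs BT (@block_diff T k l Tk Tl kl))
           (mem_all_diffs BT' (@block_diff T' k' l' Tk' Tl' kl')).
  have [[ltij ltij' eqD]|[ltij ltij' eqD]|[ltij ltij' eqD]|[ltij ltij' eqD]] :=
    eqmod_gaps neij (ltT _ _ BT Ti) (ltT _ _ BT Tj) (ltT _ _ BT' Ti') (ltT _ _ BT' Tj') eqd.
  + by have [-> ->] := key i j i' j' Ti Tj Ti' Tj' ltij ltij' eqD.
  + by have [-> _ ->] := key j i j' i' Tj Ti Tj' Ti' ltij ltij' eqD.
  + by case: (sd i j j' i' Ti Tj ltij Tj' Ti' ltij').
  + by case: (sd j i i' j' Tj Ti ltij Ti' Tj' ltij').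
Qed.

Definition perfect (t : nat) (B : seq (nat * nat * nat)) : bool :=
  perm_eq (all_diffs B) (iota 1 (6 * t)).

Lemma size_all_diffs B : size (all_diffs B) = 6 * size B.
Proof. by elim: B => [//|[[x y] z] B IH]; rewrite /all_diffs /= -/(all_diffs B) IH; lia. Qed.

Lemma OOC_of_perfect v t B :
    perfect t B -> 12 * t < v -> (v - 1) %/ 12 = t ->
  exists C : seq (seq bool), is_optimal_OOC v 4 C.
Proof.
move=> permB ltv eqt; exists (map (codeword v) (map block B)).
have memB d : d \in all_diffs B -> 0 < d <= 6 * t.
  by rewrite (perm_mem permB) mem_iota; lia.
split; last by have /perm_size := permB; rewrite size_all_diffs size_iota !size_map; lia.
apply: OOC_of_triples => [|d /memB|d e /memB + /memB]; try lia.
by rewrite (perm_uniq permB) iota_uniq.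
Qed.

Local Open Scope Z_scope.

(** * Covering an interval by affine progressions *)

Definition affine := (Z * Z)%type.
Definition ev (n : Z) (p : affine) : Z := p.1 * n + p.2.
Definition add (p q : affine) : affine := (p.1 + q.1, p.2 + q.2).
Definition scale (c : Z) (p : affine) : affine := (c * p.1, c * p.2).
Definition sub (p q : affine) : affine := (p.1 - q.1, p.2 - q.2).
Definition shift (p : affine) (c : Z) : affine := (p.1, p.2 + c).

Lemma ev_add n p q : ev n (add p q) = ev n p + ev n q.
Proof. rewrite /ev /=; lia. Qed.
Lemma ev_scale n c p : ev n (scale c p) = c * ev n p.
Proof. rewrite /ev /=; lia. Qed.
Lemma ev_sub n p q : ev n (sub p q) = ev n p - ev n q.
Proof. rewrite /ev /=; lia. Qed.
Lemma ev_shift n p c : ev n (shift p c) = ev n p + c.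
Proof. rewrite /ev /=; lia. Qed.

Definition evE := (ev_add, ev_scale, ev_sub, ev_shift).

Definition nonneg (n0 : Z) (p : affine) : bool := (0 <=? p.1) && (0 <=? ev n0 p).

Lemma nonnegP n0 n p : nonneg n0 p -> n0 <= n -> 0 <= ev n p.
Proof. by rewrite /nonneg /ev => /andP[]; nia. Qed.

Definition progression := (affine * Z * affine)%type.
Definition low (A : progression) := A.1.1.
Definition step (A : progression) := A.1.2.
Definition len (A : progression) := A.2.

Definition high (A : progression) : affine :=
  add (low A) (scale (step A) (shift (len A) (-1))).

Definition in_progression (n : Z) (A : progression) (d : Z) : Prop :=
  exists j, 0 <= j < ev n (len A) /\ d = ev n (low A) + step A * j.

(** As the length may grow with [n], a member is recognised by a distance from either end that is
    constant in [n], divisible by the step, and within the length. *)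
Definition point (n0 : Z) (p : affine) (A : progression) : bool :=
  let near (e : affine) :=
    [&& e.1 =? 0, 0 <=? e.2, e.2 mod step A =? 0 & nonneg n0 (shift (len A) (- (e.2 / step A) - 1))] in
  (0 <? step A) && (near (sub p (low A)) || near (sub (high A) p)).

Lemma pointP n0 n p A : n0 <= n -> point n0 p A -> in_progression n A (ev n p).
Proof.
move=> len0 /andP[/Z.ltb_lt s_gt0 /orP[]] /and4P[/Z.eqb_eq e1 /Z.leb_le e2 /Z.eqb_eq em /nonnegP/(_ len0)];
  rewrite evE => lt_len.
- have := ev_sub n p (low A); rewrite {1}/ev e1 => eqd.
  have /Z.div_exact := em => /(_ ltac:(lia)) eqq.
  exists ((sub p (low A)).2 / step A); split; last by lia.
  by have := Z.div_pos _ _ e2 s_gt0; lia.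
- have := ev_sub n (high A) p; rewrite {1}/ev e1 /high !evE => eqd.
  have /Z.div_exact := em => /(_ ltac:(lia)) eqq.
  (* Here the distance is measured from the top, so the index counts down from the last one. *)
  exists (ev n (len A) - 1 - (sub (high A) p).2 / step A); split; last first.
    by move: eqq eqd; rewrite /high; nia.
  by have := Z.div_pos _ _ e2 s_gt0; lia.
Qed.

(* The distance from [low A] to [p] must not depend on [n], so that its residue modulo [s] is known. *)
Definition layers (n0 : Z) (p q : affine) (s : Z) (As : seq progression) : seq progression :=
  [seq A <- As | [&& step A =? s, (sub p (low A)).1 =? 0, 0 <=? (sub p (low A)).2
                   & nonneg n0 (sub (high A) q)]].

(** Here [r] is the residue of [d - p] modulo [s]; adding the constant distance from [low A] to [p]
    gives that of [d - low A]. Layers in all residue classes cover everything from [p] to [q]. *)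
Definition full (n0 : Z) (p q : affine) (s : Z) (As : seq progression) : bool :=
  all (fun r : nat => has (fun A => ((sub p (low A)).2 + Z.of_nat r) mod s =? 0) (layers n0 p q s As))
      (iota 0 (Z.to_nat s)).

Lemma fullP n0 n p q s As d :
    n0 <= n -> 0 < s -> full n0 p q s As -> ev n p <= d <= ev n q ->
  exists2 A, A \in As & in_progression n A d.
Proof.
move=> len0 s_gt0 /allP fullA dpq.
have [m1 m2] := Z.mod_pos_bound (d - ev n p) s s_gt0.
have /hasP[A] := fullA (Z.to_nat ((d - ev n p) mod s)) ltac:(rewrite mem_iota; lia).
rewrite mem_filter => /andP[/and4P[/Z.eqb_eq sA /Z.eqb_eq e1 /Z.leb_le e2 /nonnegP/(_ len0)]].
rewrite ev_sub => leqh AsA; rewrite Z2Nat.id // Z.add_comm Zplus_mod_idemp_l => /Z.eqb_eq dm.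
exists A => //; have := ev_sub n p (low A); rewrite {1}/ev e1 => eqd.
have /Z.div_exact := dm => /(_ ltac:(lia)) eqq.
exists ((d - ev n p + (sub p (low A)).2) / s); rewrite sA; split; last lia.
split; first by apply: Z.div_pos; lia.
by move: leqh; rewrite /high !evE sA; nia.
Qed.

(** The smaller function for large [n]. This only guides the choice of an endpoint: [full] checks it
    for all [n >= n0]. *)
Definition lower (p q : affine) : affine :=
  if (p.1 <? q.1) || ((p.1 =? q.1) && (p.2 <=? q.2)) then p else q.

Definition next_full (n0 : Z) (As : seq progression) (p : affine) (s : Z) : option affine :=
  let long := [seq high A | A <- As & [&& step A =? s, (sub p (low A)).1 =? 0,
                 0 <=? (sub p (low A)).2 & p.1 <? (high A).1]] in
  if long is h :: hs then
    let q := foldr lower h hs in if full n0 p q s As then Some (shift q 1) else None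
  else None.

(* If the result is [Some q], the integers from [p] to [q - 1] are covered. *)
Definition next (n0 : Z) (As : seq progression) (p : affine) : option affine :=
  if next_full n0 As p 1 is Some q then Some q
  else if next_full n0 As p 2 is Some q then Some q
  else if next_full n0 As p 3 is Some q then Some q
  else if has (point n0 p) As then Some (shift p 1) else None.

Fixpoint reaches (n0 : Z) (As : seq progression) (fuel : nat) (p target : affine) : bool :=
  if (p.1 =? target.1) && (p.2 =? target.2) then true
  else if fuel is fuel'.+1 then
    if next n0 As p is Some q then reaches n0 As fuel' q target else false
  else false.

Definition covered (n : Z) (As : seq progression) (d : Z) : Prop :=
  exists2 A, A \in As & in_progression n A d.

Lemma next_fullP n0 n As p s q d :
    n0 <= n -> 0 < s -> next_full n0 As p s = Some q -> ev n p <= d < ev n q ->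
  covered n As d.
Proof.
rewrite /next_full => len0 s_gt0; case: [seq _ | _ <- _ & _] => // h hs.
case: ifP => // fullA [<-]; rewrite ev_shift => dpq.
by apply: fullP fullA _ => //; lia.
Qed.

Lemma nextP n0 n As p q d :
  n0 <= n -> next n0 As p = Some q -> ev n p <= d < ev n q -> covered n As d.
Proof.
rewrite /next => len0.
case E1: (next_full _ _ _ 1) => [q1|]; first by move=> [<-]; apply: next_fullP E1.
case E2: (next_full _ _ _ 2) => [q1|]; first by move=> [<-]; apply: next_fullP E2.
case E3: (next_full _ _ _ 3) => [q1|]; first by move=> [<-]; apply: next_fullP E3.
case: ifP => // /hasP[A AsA Ap] [<-]; rewrite ev_shift => dp.
by exists A => //; have -> : d = ev n p by [lia]; apply: pointP Ap.
Qed.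

Lemma reachesP n0 n As fuel p target d :
    n0 <= n -> reaches n0 As fuel p target -> ev n p <= d < ev n target ->
  covered n As d.
Proof.
move=> len0; elim: fuel p => [|fuel IH] p /=; case: ifP => [/andP[/Z.eqb_eq e1 /Z.eqb_eq e2] _|_].
- by rewrite /ev e1 e2; lia.
- by [].
- by rewrite /ev e1 e2; lia.
case E: next => [q|] // /IH IHq dpt.
by have [ltdq|leqd] := Z.lt_ge_cases d (ev n q); [apply: nextP E _ | apply: IHq]; lia.
Qed.

(** * Templates: families of triples depending on [n] *)

(* The triples [(x + dx * j, y + dy * j, z + dz * j)] for [0 <= j < l], as [(x, y, z, (dx, dy, dz), l)]. *)
Definition family := (affine * affine * affine * (Z * Z * Z) * affine)%type.

Definition copies (F : family) : affine := F.2.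

Definition triple_at (n : Z) (F : family) (j : Z) : Z * Z * Z :=
  let: (x, y, z, (dx, dy, dz), _) := F in (ev n x + dx * j, ev n y + dy * j, ev n z + dz * j).

Definition family_triples (n : Z) (F : family) : seq (Z * Z * Z) :=
  [seq triple_at n F (Z.of_nat j) | j <- iota 0 (Z.to_nat (ev n (copies F)))].

Definition triples (n : Z) (T : seq family) : seq (Z * Z * Z) :=
  flatten (map (family_triples n) T).

Definition zdiffs (T : Z * Z * Z) : seq Z :=
  let: (x, y, z) := T in [:: x; y; z; x + y; y + z; x + y + z].

(* A family with step 0 has a single member, so its step may be taken to be 1. *)
Definition ascending (p : affine) (s : Z) (l : affine) : progression :=
  if 0 <? s then (p, s, l)
  else if s <? 0 then (add p (scale s (shift l (-1))), - s, l)
  else (p, 1, (0, 1)).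

Definition family_progressions (F : family) : seq progression :=
  let: (x, y, z, (dx, dy, dz), l) := F in
  [:: ascending x dx l; ascending y dy l; ascending z dz l;
      ascending (add x y) (dx + dy) l; ascending (add y z) (dy + dz) l;
      ascending (add (add x y) z) (dx + dy + dz) l].

Definition total (T : seq family) : affine := foldr (fun F => add (copies F)) (0, 0) T.

(** Every family must be nonempty. The walk starts at the constant 1, and its target is excluded
    from the covered range, hence the final shift by 1. The fuel 1000 is just a generous bound. *)
Definition template (n0 : Z) (T : seq family) : bool :=
  all (fun F => nonneg n0 (shift (copies F) (-1))) T &&
  reaches n0 (flatten (map family_progressions T)) 1000 (0, 1) (shift (scale 6 (total T)) 1).

Lemma ascendingP n p s l d :
    0 < ev n l -> in_progression n (ascending p s l) d ->
  exists j, 0 <= j < ev n l /\ d = ev n p + s * j.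
Proof.
move=> l_gt0; rewrite /ascending.
case: ifP => [_|/Z.ltb_ge s_le0]; first by case=> j [? ->]; exists j.
case: ifP => [_|/Z.ltb_ge s_ge0] [j []]; rewrite /low /step /len.
  (* A descending progression is read backwards. *)
  by rewrite /= !evE => jl ->; exists (ev n l - 1 - j); nia.
rewrite [_.1.2]/= Z.mul_1_l => jl ->; exists 0; move: jl l_gt0; rewrite /ev /=; lia.
Qed.

Lemma family_progressionsP n (F : family) (A : progression) d :
    0 < ev n (copies F) -> A \in family_progressions F -> in_progression n A d ->
  exists j, 0 <= j < ev n (copies F) /\ d \in zdiffs (triple_at n F j).
Proof.
case: F => [[[[x y] z] [[dx dy] dz]] l]; rewrite /copies /= !inE => l_gt0 FA Ad; move: FA.
by do ![case/orP] => /eqP eqA; move: Ad; rewrite eqA => /(ascendingP l_gt0)[j [jl ->]];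
  exists j; split=> //; rewrite !inE ?evE -!(rwP orP) -!(rwP eqP); lia.
Qed.

Lemma covered_triples n T d :
    all (fun F => 0 <? ev n (copies F)) T ->
    covered n (flatten (map family_progressions T)) d ->
  d \in flatten (map zdiffs (triples n T)).
Proof.
move=> /allP T_gt0 [A /flattenP[_ /mapP[F TF ->] FA] Ad].
have /T_gt0/Z.ltb_lt l_gt0 := TF.
have [j [jl dj]] := family_progressionsP l_gt0 FA Ad.
apply/flattenP; exists (zdiffs (triple_at n F j)) => //; apply: map_f.
apply/flattenP; exists (family_triples n F); first exact: map_f.
apply/mapP; exists (Z.to_nat j); last by rewrite Z2Nat.id //; lia.
by rewrite mem_iota; lia.
Qed.

Lemma size_triples n T :
    all (fun F => 0 <? ev n (copies F)) T ->
  Z.of_nat (size (triples n T)) = ev n (total T).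
Proof.
rewrite /triples; elim: T => [//|F T IH] /= /andP[/Z.ltb_lt F_gt0 /IH IHT].
by rewrite size_cat /family_triples size_map size_iota Nat2Z.inj_add IHT ev_add; lia.
Qed.

Definition to_nat3 (T : Z * Z * Z) : nat * nat * nat :=
  (Z.to_nat T.1.1, Z.to_nat T.1.2, Z.to_nat T.2).

Lemma size_zdiffs B : size (flatten (map zdiffs B)) = (6 * size B)%N.
Proof. by elim: B => [//|[[x y] z] B IH] /=; rewrite IH; lia. Qed.

(** [Z.to_nat] truncates negative numbers, so it respects the sums only thanks to positivity of [x],
    [y], [z], which are themselves listed differences. *)
Lemma all_diffs_to_nat B :
    {in flatten (map zdiffs B), forall d, 0 < d} ->
  all_diffs (map to_nat3 B) = map Z.to_nat (flatten (map zdiffs B)).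
Proof.
elim: B => [//|[[x y] z] B IH].
have -> : flatten (map zdiffs ((x, y, z) :: B)) = zdiffs (x, y, z) ++ flatten (map zdiffs B) by [].
move=> posB; have pos d : d \in zdiffs (x, y, z) -> 0 < d.
  by move=> xd; apply: posB; rewrite mem_cat xd.
have x0 : 0 < x by apply: pos; rewrite !inE eqxx ?orbT.
have y0 : 0 < y by apply: pos; rewrite !inE eqxx ?orbT.
have z0 : 0 < z by apply: pos; rewrite !inE eqxx ?orbT.
have {}IH : all_diffs (map to_nat3 B) = map Z.to_nat (flatten (map zdiffs B)).
  by apply: IH => d Bd; apply: posB; rewrite mem_cat Bd orbT.
rewrite /all_diffs /= -/(all_diffs _) IH /to_nat3 /=.
by congr (_ :: _ :: _ :: _ :: _ :: _ :: _); lia.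
Qed.

Lemma template_perfect n0 n T :
    template n0 T -> n0 <= n ->
  exists B, perfect (Z.to_nat (ev n (total T))) B.
Proof.
move=> /andP[/allP T_ge1 reachT] len0.
have T_gt0 : all (fun F => 0 <? ev n (copies F)) T.
  apply/allP => F /T_ge1/nonnegP/(_ len0); rewrite ev_shift => ?; apply/Z.ltb_lt; lia.
have szT := size_triples T_gt0.
set t := Z.to_nat _; pose U := flatten (map zdiffs (triples n T)).
have szU : size U = (6 * t)%N.
  by rewrite /U size_zdiffs /t; lia.
have subU : {subset map Z.of_nat (iota 1 (6 * t)) <= U}.
  move=> x /mapP[d]; rewrite mem_iota => dt {x}->; apply: covered_triples => //.
  have ev1 : ev n (0, 1) = 1 by rewrite /ev /=; lia.
  by apply: reachesP len0 reachT _; rewrite ev1 ev_shift ev_scale; move: dt; rewrite /t; lia.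
have uI : uniq (map Z.of_nat (iota 1 (6 * t))).
  by rewrite map_inj_uniq ?iota_uniq // => i j; lia.
have leU : (size U <= size (map Z.of_nat (iota 1 (6 * t))))%N.
  by rewrite size_map size_iota szU.
(* The counting argument: [U] contains a duplicate-free list at least as long as itself, so it has
   the same elements and no repetition. *)
have [_ eqU] := uniq_min_size uI subU leU.
have permU : perm_eq U (map Z.of_nat (iota 1 (6 * t))).
  by rewrite perm_sym uniq_perm // (leq_size_uniq uI).
exists (map to_nat3 (triples n T)); rewrite /perfect.
rewrite all_diffs_to_nat => [|d]; last by rewrite -/U -eqU => /mapP[i]; rewrite mem_iota => ? ->; lia.
rewrite -/U (perm_trans (perm_map Z.to_nat permU)) // -map_comp.
by rewrite map_id_in // => i _ /=; rewrite Nat2Z.id.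
Qed.

(** * Perfect families *)

(* Found by computer: simulated annealing for the six moving families, exact cover for the single
triples. The coefficients of [n] in the moving families are the same in all six templates. *)
Definition template0 : seq family := [::
  ((0, 4), (26, -2), (5, -2), (3, -1, -1), (1, -2));
  ((7, 3), (4, -1), (17, -3), (3, -1, -1), (1, -2));
  ((7, 5), (7, -2), (18, -2), (3, -1, -1), (1, -2));
  ((7, 4), (22, -3), (6, -2), (3, -1, -1), (1, -2));
  ((11, -2), (0, 5), (23, -4), (-1, 3, -1), (1, -2));
  ((14, -1), (0, 3), (19, -2), (-1, 3, -1), (1, -2));
  ((3, -3), (26, 0), (6, 0), (0, 0, 0), (0, 1));
  ((3, 0), (25, -3), (7, 1), (0, 0, 0), (0, 1));
  ((6, -1), (7, 2), (16, -2), (0, 0, 0), (0, 1));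
  ((10, -2), (0, 2), (21, -3), (0, 0, 0), (0, 1));
  ((11, 1), (10, -3), (13, 0), (0, 0, 0), (0, 1));
  ((3, 1), (16, -1), (17, 0), (0, 0, 0), (0, 1));
  ((14, 0), (3, -2), (14, 1), (0, 0, 0), (0, 1));
  ((3, -1), (19, -1), (7, 0), (0, 0, 0), (0, 1));
  ((4, 0), (25, 0), (7, -1), (0, 0, 0), (0, 1));
  ((11, -1), (0, 1), (25, -2), (0, 0, 0), (0, 1));
  ((5, -1), (18, 0), (13, -2), (0, 0, 0), (0, 1));
  ((5, 0), (13, -1), (10, -1), (0, 0, 0), (0, 1))].

Definition template1 : seq family := [::
  ((0, 3), (26, 2), (5, 0), (3, -1, -1), (1, -1));
  ((7, 8), (4, -2), (17, 0), (3, -1, -1), (1, -3));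
  ((7, 6), (7, -1), (18, 2), (3, -1, -1), (1, -2));
  ((7, 4), (22, 3), (6, -1), (3, -1, -1), (1, -1));
  ((11, -1), (0, 8), (23, 0), (-1, 3, -1), (1, -3));
  ((14, 2), (0, 4), (19, 1), (-1, 3, -1), (1, -2));
  ((11, 0), (0, 5), (23, 1), (0, 0, 0), (0, 1));
  ((0, 2), (7, 3), (21, 0), (0, 0, 0), (0, 1));
  ((11, 1), (10, 0), (11, 4), (0, 0, 0), (0, 1));
  ((14, 4), (3, -1), (16, 3), (0, 0, 0), (0, 1));
  ((10, 2), (3, -2), (13, 4), (0, 0, 0), (0, 1));
  ((11, 3), (10, -1), (13, 3), (0, 0, 0), (0, 1));
  ((6, 0), (17, 4), (6, 1), (0, 0, 0), (0, 1));
  ((3, 0), (13, 1), (19, 3), (0, 0, 0), (0, 1));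
  ((10, 1), (7, 0), (14, 3), (0, 0, 0), (0, 1));
  ((7, 1), (11, 2), (17, 2), (0, 0, 0), (0, 1));
  ((4, -1), (19, 4), (13, 2), (0, 0, 0), (0, 1));
  ((4, 0), (0, 1), (25, 2), (0, 0, 0), (0, 1));
  ((3, 1), (26, 3), (7, 2), (0, 0, 0), (0, 1))].

Definition template2 : seq family := [::
  ((0, 5), (26, 6), (5, 0), (3, -1, -1), (1, -2));
  ((7, 5), (4, 0), (17, 4), (3, -1, -1), (1, -2));
  ((7, 7), (7, 0), (18, 4), (3, -1, -1), (1, -2));
  ((7, 6), (22, 5), (6, 1), (3, -1, -1), (1, -1));
  ((11, 3), (0, 3), (23, 6), (-1, 3, -1), (1, -1));
  ((14, 4), (0, 4), (19, 5), (-1, 3, -1), (1, -2));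
  ((3, -2), (7, 1), (19, 8), (0, 0, 0), (0, 1));
  ((3, 0), (10, 1), (18, 7), (0, 0, 0), (0, 1));
  ((3, 1), (25, 6), (4, 2), (0, 0, 0), (0, 1));
  ((4, 1), (21, 6), (11, 4), (0, 0, 0), (0, 1));
  ((10, 3), (3, 2), (22, 6), (0, 0, 0), (0, 1));
  ((7, 4), (7, 2), (19, 6), (0, 0, 0), (0, 1));
  ((14, 5), (5, 2), (17, 5), (0, 0, 0), (0, 1));
  ((5, 1), (16, 4), (13, 6), (0, 0, 0), (0, 1));
  ((6, 2), (10, 4), (13, 3), (0, 0, 0), (0, 1));
  ((0, 1), (18, 5), (13, 4), (0, 0, 0), (0, 1));
  ((0, 2), (16, 3), (17, 6), (0, 0, 0), (0, 1));
  ((7, 3), (3, -1), (23, 8), (0, 0, 0), (0, 1))].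

Definition template3 : seq family := [::
  ((0, 4), (26, 10), (5, 2), (3, -1, -1), (1, -1));
  ((7, 9), (4, 0), (17, 6), (3, -1, -1), (1, -2));
  ((7, 7), (7, 2), (18, 8), (3, -1, -1), (1, -1));
  ((7, 8), (22, 9), (6, 2), (3, -1, -1), (1, -2));
  ((11, 5), (0, 3), (23, 10), (-1, 3, -1), (1, -1));
  ((14, 5), (0, 5), (19, 8), (-1, 3, -1), (1, -2));
  ((5, 4), (21, 11), (10, 2), (0, 0, 0), (0, 1));
  ((5, 3), (6, 3), (23, 11), (0, 0, 0), (0, 1));
  ((3, 1), (14, 8), (17, 7), (0, 0, 0), (0, 1));
  ((4, 3), (13, 5), (18, 9), (0, 0, 0), (0, 1));
  ((7, 4), (21, 8), (7, 6), (0, 0, 0), (0, 1));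
  ((7, 3), (3, 0), (18, 10), (0, 0, 0), (0, 1));
  ((7, 5), (4, 2), (21, 9), (0, 0, 0), (0, 1));
  ((3, -1), (19, 11), (4, 1), (0, 0, 0), (0, 1));
  ((0, 1), (14, 6), (19, 10), (0, 0, 0), (0, 1));
  ((10, 5), (16, 7), (10, 6), (0, 0, 0), (0, 1));
  ((0, 2), (16, 6), (13, 7), (0, 0, 0), (0, 1));
  ((10, 4), (3, 2), (19, 9), (0, 0, 0), (0, 1))].

Definition template4 : seq family := [::
  ((0, 5), (26, -12), (5, -3), (3, -1, -1), (1, -3));
  ((7, 3), (4, -3), (17, -8), (3, -1, -1), (1, -3));
  ((7, 2), (7, -4), (18, -8), (3, -1, -1), (1, -2));
  ((7, 4), (22, -10), (6, -4), (3, -1, -1), (1, -3));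
  ((11, -5), (0, 4), (23, -9), (-1, 3, -1), (1, -2));
  ((14, -6), (0, 3), (19, -7), (-1, 3, -1), (1, -2));
  ((7, 1), (3, -4), (25, -9), (0, 0, 0), (0, 1));
  ((6, -3), (22, -8), (7, 0), (0, 0, 0), (0, 1));
  ((0, 2), (28, -12), (3, -1), (0, 0, 0), (0, 1));
  ((10, -6), (11, -3), (11, -4), (0, 0, 0), (0, 1));
  ((3, -2), (4, 0), (25, -10), (0, 0, 0), (0, 1));
  ((7, -1), (4, -1), (22, -9), (0, 0, 0), (0, 1));
  ((13, -4), (3, -3), (18, -5), (0, 0, 0), (0, 1));
  ((5, -2), (23, -7), (6, -2), (0, 0, 0), (0, 1));
  ((17, -7), (0, 1), (19, -6), (0, 0, 0), (0, 1));
  ((7, -3), (16, -5), (10, -4), (0, 0, 0), (0, 1));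
  ((5, -1), (21, -7), (10, -5), (0, 0, 0), (0, 1));
  ((3, 0), (13, -6), (13, -5), (0, 0, 0), (0, 1));
  ((14, -5), (4, -2), (14, -4), (0, 0, 0), (0, 1))].

Definition template5 : seq family := [::
  ((0, 5), (26, -7), (5, -2), (3, -1, -1), (1, -2));
  ((7, 5), (4, -3), (17, -4), (3, -1, -1), (1, -3));
  ((7, 4), (7, -2), (18, -5), (3, -1, -1), (1, -2));
  ((7, 3), (22, -5), (6, -2), (3, -1, -1), (1, -2));
  ((11, -2), (0, 3), (23, -5), (-1, 3, -1), (1, -2));
  ((14, -3), (0, 4), (19, -4), (-1, 3, -1), (1, -2));
  ((7, 0), (0, 2), (26, -6), (0, 0, 0), (0, 1));
  ((10, -4), (11, 0), (10, -3), (0, 0, 0), (0, 1));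
  ((10, 0), (3, -3), (22, -3), (0, 0, 0), (0, 1));
  ((7, 1), (7, -1), (21, -5), (0, 0, 0), (0, 1));
  ((3, 0), (25, -5), (6, 0), (0, 0, 0), (0, 1));
  ((0, 1), (19, -2), (4, -2), (0, 0, 0), (0, 1));
  ((4, -1), (14, -2), (14, -1), (0, 0, 0), (0, 1));
  ((4, 0), (6, -1), (26, -5), (0, 0, 0), (0, 1));
  ((13, -4), (5, 0), (13, -2), (0, 0, 0), (0, 1));
  ((3, -2), (16, -1), (10, -2), (0, 0, 0), (0, 1));
  ((3, -1), (13, -1), (16, -3), (0, 0, 0), (0, 1));
  ((5, -1), (17, -3), (11, -1), (0, 0, 0), (0, 1))].

Local Close Scope Z_scope.

(** The template instances used here have some empty families, which [template] rejects, so they are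
    checked directly. For [t = 13], [template1] would need families of negative length. *)
Definition small_perfect (t : nat) : seq (nat * nat * nat) :=
  match t with
  | 4 => [::
      (4, 11, 9); (1, 6, 16); (2, 12, 5); (3, 10, 8)]
  | 5 => [::
      (8, 13, 9); (3, 2, 23); (4, 14, 6); (10, 7, 12); (1, 15, 11)]
  | 6 => [::
      (11, 13, 12); (1, 27, 7); (4, 18, 8); (3, 20, 9); (5, 10, 6); (2, 17, 14)]
  | 7 => [::
      (15, 2, 25); (6, 1, 31); (4, 26, 9); (3, 16, 21); (12, 10, 14); (5, 18, 11);
      (8, 20, 13)]
  | 8 => [::
      (3, 25, 20); (8, 2, 34); (12, 14, 17); (9, 21, 16); (1, 32, 7); (6, 13, 22);
      (4, 11, 27); (18, 5, 24)]
  | 9 => [::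
      (12, 27, 15); (4, 31, 17); (7, 30, 16); (21, 5, 24); (6, 34, 9); (20, 2, 23);
      (10, 28, 13); (1, 18, 14); (3, 8, 36)]
  | 10 => [::
      (5, 17, 38); (6, 34, 18); (13, 19, 27); (4, 37, 7); (2, 26, 21); (3, 42, 12);
      (23, 8, 25); (10, 14, 29); (11, 9, 30); (15, 1, 35)]
  | 11 => [::
      (4, 35, 27); (18, 13, 33); (6, 14, 45); (12, 11, 38); (7, 34, 22); (3, 21, 30);
      (19, 10, 26); (2, 50, 8); (1, 42, 5); (17, 15, 25); (9, 28, 16)]
  | 13 => [::
      (4, 43, 31); (8, 32, 36); (18, 6, 53); (12, 50, 13); (1, 34, 38); (3, 46, 11);
      (2, 23, 44); (7, 45, 19); (10, 20, 28); (17, 16, 21); (5, 22, 39); (9, 42, 14);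
      (15, 26, 29)]
  | 12 => map to_nat3 (triples 2 template0)
  | 14 => map to_nat3 (triples 2 template2)
  | 15 => map to_nat3 (triples 2 template3)
  | 16 => map to_nat3 (triples 3 template4)
  | 17 => map to_nat3 (triples 3 template5)
  | 19 => map to_nat3 (triples 3 template1)
  | _ => [::]
  end.

Lemma small_perfectP t : (4 <= t <= 17) || (t == 19) -> perfect t (small_perfect t).
Proof.
move=> t_small; have: t \in 19 :: iota 4 14 by rewrite inE mem_iota; lia.
by move: t {t_small}; apply/allP; vm_cast_no_check (erefl true).
Qed.

Lemma template_exists n0 n t a b T :
    template n0 T -> total T = (a, b) -> (n0 <= n)%Z -> (a * n + b)%Z = Z.of_nat t ->
  exists B, perfect t B.
Proof.
move=> Tok totT len0 eqt; rewrite -(Nat2Z.id t) -eqt.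
by have := template_perfect Tok len0; rewrite totT.
Qed.

(** The bounds 3 and 4 are the least [n] at which all families of the template are nonempty. *)
Lemma template0P : template 3 template0. Proof. by vm_cast_no_check (erefl true). Qed.
Lemma template1P : template 4 template1. Proof. by vm_cast_no_check (erefl true). Qed.
Lemma template2P : template 3 template2. Proof. by vm_cast_no_check (erefl true). Qed.
Lemma template3P : template 3 template3. Proof. by vm_cast_no_check (erefl true). Qed.
Lemma template4P : template 4 template4. Proof. by vm_cast_no_check (erefl true). Qed.
Lemma template5P : template 4 template5. Proof. by vm_cast_no_check (erefl true). Qed.
Lemma perfect_exists t : 4 <= t -> exists B, perfect t B.
Proof.
move=> t_ge4; have [t_small|] := boolP ((t <= 17) || (t == 19)).
  by exists (small_perfect t); apply: small_perfectP; lia.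
(* The least remaining [t] in the residue classes 0 to 5 modulo 6 are 18, 25, 20, 21, 22, 23,
   exactly where the templates start. *)
rewrite negb_or -ltnNge => /andP[t_gt17 t_neq19].
have [n nE] : exists n, n = Z.of_nat (t %/ 6) by eexists.
have : t %% 6 < 6 by rewrite ltn_mod.
case r: (t %% 6) => [|[|[|[|[|[|//]]]]]] _.
- by apply: (@template_exists _ n t 6 0 _ template0P erefl); lia.
- by apply: (@template_exists _ n t 6 1 _ template1P erefl); lia.
- by apply: (@template_exists _ n t 6 2 _ template2P erefl); lia.
- by apply: (@template_exists _ n t 6 3 _ template3P erefl); lia.
(* The last two templates have [6 n - 2] and [6 n - 1] triples, so they are used at the quotient
   plus one. *)
- by apply: (@template_exists _ (n + 1) t 6 (-2) _ template4P erefl); lia.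
- by apply: (@template_exists _ (n + 1) t 6 (-1) _ template5P erefl); lia.
Qed.

(** * Codes with fewer than four codewords, and the theorem *)

(** Weaker than perfection: differences may exceed [v / 2], as long as they stay distinct up to sign
    modulo [v]. *)
Definition packing (v : nat) (B : seq (nat * nat * nat)) : bool :=
  [&& uniq (all_diffs B), all (fun d => 0 < d < v) (all_diffs B)
    & allrel (fun d e => d + e != v) (all_diffs B) (all_diffs B)].

Lemma OOC_of_packing v B :
    packing v B -> (v - 1) %/ 12 = size B ->
  exists C : seq (seq bool), is_optimal_OOC v 4 C.
Proof.
case/and3P=> uB /allP rB /allrelP sB szB; exists (map (codeword v) (map block B)).
split; last by rewrite !size_map szB.
by apply: OOC_of_triples => // d e Bd Be; apply/eqP/sB.
Qed.

Theorem theorem1p3 (v : nat) :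
  0 < v ->
  (v %% 12 = 1 \/ v %% 12 = 4) ->
  v \notin [:: 16; 25; 28] ->
  exists C : seq (seq bool), is_optimal_OOC v 4 C.
Proof.
move=> v_gt0 v12; rewrite !inE !negb_or => /and3P[v16 v25 v28].
have [t_ge4|t_lt4] := leqP 4 ((v - 1) %/ 12).
  by have [B permB] := perfect_exists t_ge4; apply: OOC_of_perfect permB _ _; lia.
have : v \in [:: 1; 4; 13; 37; 40] by rewrite !inE; lia.
rewrite !inE => /or4P[|||/orP[]] /eqP->.
(* For [v = 1] and [v = 4] the optimal size is 0, attained by the empty code. *)
- exact: (@OOC_of_packing 1 [::]).
- exact: (@OOC_of_packing 4 [::]).
(* The block is the planar difference set {0, 1, 3, 9} modulo 13. *)
- exact: (@OOC_of_packing 13 [:: (1, 2, 6)]).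
- exact: (@OOC_of_packing 37 [:: (16, 7, 13); (6, 26, 2); (8, 10, 15)]).
- exact: (@OOC_of_packing 40 [:: (10, 6, 11); (28, 3, 5); (18, 1, 14)]).
Qed.
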